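(* Let $A=\sigma(R)\langle x_1,\dots,x_n\rangle$ be a $\sigma$-PBW extension of $R$ (under the standing assumptions below). Let $M\neq0$ be a submodule of $A^m$ and let $G$ be a finite set of nonzero generators of $M$. The following are equivalent: (i) $G$ is a Gröbner basis of $M$. (ii) For every $F=\{\mathbf g_1,\dots,\mathbf g_s\}\subseteq G$ with $\mathbf X_F\neq\mathbf 0$, every $\theta\in\mathbb N^n$, and every $(b_1,\dots,b_s)\in B_{F,\theta}$, we have $\sum_{i=1}^sb_ix^{\gamma_i+\theta}\mathbf g_i\xrightarrow{G}_+\mathbf 0$. In particular, if $G$ is a Gröbner basis of $M$, then for all such $F$ and all $(b_1,\dots,b_s)\in B_F$ we have $\sum_{i=1}^sb_ix^{\gamma_i}\mathbf g_i\xrightarrow{G}_+\mathbf 0$.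
   Context: Let $R\subseteq A$ be rings. $A$ is a $\sigma$-PBW extension of $R$, written $A=\sigma(R)\langle x_1,\dots,x_n\rangle$, if there are $x_1,\dots,x_n\in A\setminus R$ such that: (i) $A$ is a free left $R$-module with basis $\mathrm{Mon}(A)=\{x^\alpha=x_1^{\alpha_1}\cdots x_n^{\alpha_n}:\alpha\in\mathbb N^n\}$, with $x^0=1$; (ii) for every $i$ and every $r\in R\setminus\{0\}$ there is $c_{i,r}\in R\setminus\{0\}$ with $x_ir-c_{i,r}x_i\in R$; (iii) for all $i,j$ there is $c_{i,j}\in R\setminus\{0\}$ with $x_jx_i-c_{i,j}x_ix_j\in R+Rx_1+\dots+Rx_n$. There are injective ring endomorphisms $\sigma_i$ of $R$ and $\sigma_i$-derivations $\delta_i$ with $x_ir=\sigma_i(r)x_i+\delta_i(r)$. Write $\sigma^\alpha=\sigma_1^{\alpha_1}\circ\cdots\circ\sigma_n^{\alpha_n}$ and $|\alpha|=\sum\alpha_i$. For $\alpha,\beta$ there are unique $c_{\alpha,\beta}\in R$ (left invertible) and $p_{\alpha,\beta}\in A$ with $x^\alpha x^\beta=c_{\alpha,\beta}x^{\alpha+\beta}+p_{\alpha,\beta}$, where $p_{\alpha,\beta}=0$ or $\deg p_{\alpha,\beta}<|\alpha+\beta|$. Standing assumptions: $R$ is left Gröbner soluble (left Noetherian; left ideal membership decidable with computable coefficients; finite generating sets of $\mathrm{Syz}_R[r_1\cdots r_k]=\{(b_1,\dots,b_k)\in R^k:\sum b_ir_i=0\}$ computable). $\mathrm{Mon}(A)$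 carries a monomial order, i.e. a total order $\succeq$ with: (a) $x^\beta\succeq x^\alpha\Rightarrow lm(x^\gamma x^\beta x^\lambda)\succeq lm(x^\gamma x^\alpha x^\lambda)$; (b) $x^\alpha\succeq1$; (c) $|\beta|\ge|\alpha|\Rightarrow x^\beta\succeq x^\alpha$. $A^m$ is the free left $A$-module of column vectors with canonical basis $\mathbf e_i$. Monomials of $A^m$ are $x^\alpha\mathbf e_i$, with $\mathrm{ind}=i$, $\exp=\alpha$, $\deg=|\alpha|$. The monomial $x^\alpha\mathbf e_i$ divides $x^\beta\mathbf e_j$ iff $i=j$ and $\beta_k\ge\alpha_k$ for all $k$. The lcm of $x^\alpha\mathbf e_i$ and $x^\beta\mathbf e_j$ is $\mathbf 0$ if $i\neq j$, and $x^\gamma\mathbf e_i$ with $\gamma_k=\max(\alpha_k,\beta_k)$ if $i=j$. $\mathrm{Mon}(A^m)$ carries a monomial order, i.e. a total order with: (i) $lm(x^\beta x^\alpha)\mathbf e_i\succeq x^\alpha\mathbf e_i$; (ii) $x^\beta\mathbf e_j\succeq x^\alpha\mathbf e_i\Rightarrow lm(x^\gamma x^\beta)\mathbf e_j\succeq lm(x^\gamma x^\alpha)\mathbf e_i$; (iii) $\deg\mathbf X\ge\deg\mathbf Y\Rightarrow\mathbf X\succeq\mathbf Y$. For nonzero $\mathbf f=c_1\mathbf X_1+\dots+c_t\mathbf X_t$ with $c_i\in R\setminus\{0\}$ and $\mathbf X_1\succ\dots\succ\mathbf X_t$, set $lm(\mathbf f)=\mathbf X_1$, $lc(\mathbf f)=c_1$,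 $lt(\mathbf f)=c_1\mathbf X_1$. Also $lm(\mathbf 0)=\mathbf 0$ and $\mathbf X\succ\mathbf 0$. Reduction. Let $F$ be a finite set of nonzero vectors and $\mathbf f,\mathbf h\in A^m$. We write $\mathbf f\xrightarrow{F}\mathbf h$ (one step) if there are $\mathbf f_1,\dots,\mathbf f_t\in F$ and $r_1,\dots,r_t\in R$ with: (1) $lm(\mathbf f_i)\mid lm(\mathbf f)$, with $\alpha_i+\exp(lm\,\mathbf f_i)=\exp(lm\,\mathbf f)$; (2) $lc(\mathbf f)=\sum r_i\sigma^{\alpha_i}(lc\,\mathbf f_i)c_{\alpha_i,\exp(lm\,\mathbf f_i)}$; (3) $\mathbf h=\mathbf f-\sum r_ix^{\alpha_i}\mathbf f_i$. By convention $\mathbf 0\xrightarrow{F}\mathbf 0$. $\mathbf f\xrightarrow{F}_+\mathbf h$ means a finite chain of one-step reductions from $\mathbf f$ to $\mathbf h$. $\mathbf f$ is reduced w.r.t. $F$ if $\mathbf f=\mathbf 0$ or no one-step reduction of $\mathbf f$ exists; otherwise it is reducible. Gröbner basis. For a submodule $M\neq0$ of $A^m$, a nonempty finite set $G$ of nonzero vectors of $M$ is a Gröbner basis for $M$ if every nonzero $\mathbf f\in M$ is reducible w.r.t. $G$. Syzygy data. For $F=\{\mathbf g_1,\dots,\mathbf g_s\}\subseteq A^m$: - $\mathbf X_F=\mathrm{lcm}\{lm(\mathbf g_1),\dots,lm(\mathbf g_s)\}$; - $\beta_i=\exp(lm\,\mathbf g_i)$; - when $\mathbf X_F\neq\mathbf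 0$, $\gamma_i\in\mathbb N^n$ is defined by $\gamma_i+\beta_i=\exp(\mathbf X_F)$. For $\theta\in\mathbb N^n$, $B_{F,\theta}$ is a finite generating set of the left $R$-module $$S_{F,\theta}=\mathrm{Syz}_R\big[\sigma^{\gamma_1+\theta}(lc\,\mathbf g_1)c_{\gamma_1+\theta,\beta_1}\ \cdots\ \sigma^{\gamma_s+\theta}(lc\,\mathbf g_s)c_{\gamma_s+\theta,\beta_s}\big].$$ For $\theta=0$ we write $B_F=B_{F,0}$.
   Formalization: The degree conditions (c) and (iii) on the monomial orders are taken with strict inequality (larger degree implies larger monomial), since with ≥ no total order could satisfy them when n ≥ 2 or m ≥ 2; the computability assumptions on R are not needed and are dropped. *)

(* Defs.v *)
From HB Require Import structures.
From mathcomp Require Import all_boot all_order all_algebra.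
From Stdlib Require Import ClassicalEpsilon.
Unset Implicit Arguments. Unset Strict Implicit. Unset Printing Implicit Defensive.
Import GRing.Theory.
Local Open Scope ring_scope.

Notation exps n := {ffun 'I_n -> nat}.
Definition addx (n : nat) (a b : exps n) : exps n := [ffun k => (a k + b k)%N].
Definition zerox (n : nat) : exps n := [ffun _ => 0%N].
Definition unitx (n : nat) (k : 'I_n) : exps n := [ffun j => nat_of_bool (j == k)].
Definition degx (n : nat) (a : exps n) : nat := (\sum_(k < n) a k)%N.

Definition total_order (T : Type) (le : rel T) : Prop :=
  reflexive le /\ antisymmetric le /\ transitive le /\ total le.

(* leading monomial w.r.t. le of an element whose coefficient function is c:
   Some X if X is the le-greatest monomial with nonzero coefficient,
   None if there is none (i.e. the element is zero). *)
Definition lmax (R : nzRingType) (T : Type) (le : rel T) (c : T -> R) : option T :=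
  epsilon (inhabits None)
    (fun o => match o with
              | Some X => c X != 0 /\ (forall Y, c Y != 0 -> le Y X)
              | None => forall X, ~ (c X != 0 /\ (forall Y, c Y != 0 -> le Y X))
              end).

Definition left_noetherian (R : nzRingType) : Prop :=
  forall I : R -> Prop, I 0 -> (forall a b, I a -> I b -> I (a + b)) ->
    (forall r a, I a -> I (r * a)) ->
    exists s : seq R, (forall a, a \in s -> I a) /\
      (forall a, I a -> exists c : 'I_(size s) -> R, a = \sum_(i < size s) c i * s`_i).

Section PBW.
Variables (R A : nzRingType) (n : nat) (iota : {rmorphism R -> A})
          (x : 'I_n -> A) (coef : A -> exps n -> R).

Definition mono (a : exps n) : A := \prod_(k < n) x k ^+ a k.

(* A = sigma(R)<x_1,...,x_n>, R embedded in A via the injective ring map iota;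
   coef a alpha is the coefficient of x^alpha in the (unique) expansion of a. *)
Definition sigma_PBW_ext : Prop :=
  injective iota /\ (forall k r, x k <> iota r) /\
  [/\
      (forall a : A, exists s : seq (exps n), [/\ uniq s,
          (forall al, al \notin s -> coef a al = 0) &
          a = \sum_(al <- s) iota (coef a al) * mono al]),
      (forall (s : seq (exps n)) (r : exps n -> R), uniq s ->
          \sum_(al <- s) iota (r al) * mono al = 0 -> forall al, al \in s -> r al = 0),
      (forall k (r : R), r != 0 -> exists c : R, c != 0 /\
          exists r0 : R, x k * iota r - iota c * x k = iota r0) &
      (forall i j : 'I_n, exists c : R, c != 0 /\
          exists (r0 : R) (r : 'I_n -> R),
            x j * x i - iota c * x i * x j = iota r0 + \sum_(k < n) iota (r k) * x k)].

(* sigma_k, determined by x_k r = sigma_k(r) x_k + delta_k(r) *)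
Definition sig (k : 'I_n) (r : R) : R := coef (x k * iota r) (unitx n k).
Definition sigpow (a : exps n) (r : R) : R :=
  foldr (fun k acc => iter (a k) (sig k) acc) r (enum 'I_n).
Definition cab (a b : exps n) : R := coef (mono a * mono b) (addx n a b).

Definition alm (leA : rel (exps n)) (a : A) : option (exps n) := lmax R (exps n) leA (coef a).

Definition monomial_order_A (leA : rel (exps n)) : Prop :=
  [/\ total_order _ leA,
      (forall a b g l la lb, leA a b ->
         alm leA (mono g * mono a * mono l) = Some la ->
         alm leA (mono g * mono b * mono l) = Some lb -> leA la lb),
      (forall a, leA (zerox n) a) &
      (forall a b, (degx n a < degx n b)%N -> leA a b)].

Variable m : nat.
(* vectors of A^m; monomial x^alpha e_i is the pair (alpha, i) *)
Definition vcoef (f : 'cV[A]_m) (X : exps n * 'I_m) : R := coef (f X.2 0) X.1.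

Definition monomial_order_Am (leA : rel (exps n)) (leM : rel (exps n * 'I_m)) : Prop :=
  [/\ total_order _ leM,
      (forall a b (i : 'I_m) l, alm leA (mono b * mono a) = Some l -> leM (a, i) (l, i)),
      (forall a b g (i j : 'I_m) la lb, leM (a, i) (b, j) ->
         alm leA (mono g * mono a) = Some la ->
         alm leA (mono g * mono b) = Some lb -> leM (la, i) (lb, j)) &
      (forall X Y : exps n * 'I_m, (degx n Y.1 < degx n X.1)%N -> leM Y X)].

Variable leM : rel (exps n * 'I_m).

Definition vlm (f : 'cV[A]_m) : option (exps n * 'I_m) := lmax R (exps n * 'I_m) leM (vcoef f).
Definition lc (f : 'cV[A]_m) : R :=
  match vlm f with Some X => vcoef f X | None => 0 end.
Definition vexp (f : 'cV[A]_m) : exps n :=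
  match vlm f with Some X => X.1 | None => zerox n end.

Definition red1 (F : seq 'cV[A]_m) (f h : 'cV[A]_m) : Prop :=
  (f = 0 /\ h = 0) \/
  exists (t : nat) (fs : 'I_t -> 'cV[A]_m) (r : 'I_t -> R) (al : 'I_t -> exps n),
    [/\ (forall i, fs i \in F),
        (forall i, exists b (j : 'I_m),
            vlm (fs i) = Some (b, j) /\ vlm f = Some (addx n (al i) b, j)),
        lc f = \sum_(i < t) r i * sigpow (al i) (lc (fs i)) * cab (al i) (vexp (fs i)) &
        h = f - \sum_(i < t) (iota (r i) * mono (al i)) *: fs i].

Inductive redp (F : seq 'cV[A]_m) : 'cV[A]_m -> 'cV[A]_m -> Prop :=
  | redp1 f h : red1 F f h -> redp F f h
  | redpS f g h : red1 F f g -> redp F g h -> redp F f h.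

Definition submod_gen (G : seq 'cV[A]_m) (f : 'cV[A]_m) : Prop :=
  exists a : 'I_(size G) -> A, f = \sum_(i < size G) a i *: G`_i.

Definition is_GB (G : seq 'cV[A]_m) (M : 'cV[A]_m -> Prop) : Prop :=
  [/\ G != [::], (forall g, g \in G -> g != 0 /\ M g) &
      (forall f, M f -> f != 0 -> exists h, red1 G f h)].

(* syzygy data for F = {g_1, ..., g_s} (listed without repetition) *)
Definition XF_nonzero (F : seq 'cV[A]_m) : Prop :=
  F != [::] /\ exists i : 'I_m, forall g, g \in F -> exists b, vlm g = Some (b, i).
Definition expX (F : seq 'cV[A]_m) : exps n := [ffun k => (\max_(g <- F) vexp g k)%N].
Definition gam (F : seq 'cV[A]_m) (g : 'cV[A]_m) : exps n :=
  [ffun k => (expX F k - vexp g k)%N].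

Definition syz_entry (F : seq 'cV[A]_m) (th : exps n) (i : nat) : R :=
  sigpow (addx n (gam F F`_i) th) (lc F`_i) * cab (addx n (gam F F`_i) th) (vexp F`_i).

Definition in_SF (F : seq 'cV[A]_m) (th : exps n) (b : seq R) : Prop :=
  size b = size F /\ \sum_(i < size F) b`_i * syz_entry F th i = 0.

Definition gen_SF (F : seq 'cV[A]_m) (th : exps n) (Bs : seq (seq R)) : Prop :=
  (forall b, b \in Bs -> in_SF F th b) /\
  (forall b, in_SF F th b -> exists a : 'I_(size Bs) -> R,
      forall i : 'I_(size F), b`_i = \sum_(j < size Bs) a j * (nth [::] Bs j)`_i).

Definition syz_sum (F : seq 'cV[A]_m) (th : exps n) (b : seq R) : 'cV[A]_m :=
  \sum_(i < size F) (iota b`_i * mono (addx n (gam F F`_i) th)) *: F`_i.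

End PBW.

(* Main.v *)
Require Import Defs.
From HB Require Import structures.
From mathcomp Require Import all_boot all_order all_algebra.
From mathcomp Require Import zify.
From Stdlib Require Import ClassicalEpsilon.
Import GRing.Theory.
Local Open Scope ring_scope.

(** Sorting a word in the x_k by adjacent transpositions changes it, modulo shorter
    words, by a left invertible factor: condition (iii) used for (i, j) and for (j, i)
    gives c_{j,i} c_{i,j} = 1. Hence every c_{a,b} is nonzero, so lm(x^g x^a) = x^(g+a),
    the order on vector monomials is translation invariant, and, being degree compatible,
    it is well founded. A reduction step lowers the leading monomial, so over a Groebner
    basis every element of M reduces to 0.

    Conversely, write f in M as a combination of terms r x^al g with formal leading
    monomials at most X. If the coefficient of X in f is nonzero, the terms sitting at X
    give a reduction of f. Otherwise let F be the set of all g in G with lm(g) dividing X,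
    and theta = X - X_F: the coefficients of the terms sitting at X form a syzygy in
    S_{F,theta}. The corresponding combinations of generators in B_{F,theta} have no
    coefficient at X and reduce to 0, hence they are combinations of terms below X, and X
    can be lowered. *)

(** * Greatest elements of finite sets and leading monomials *)

Section FiniteMax.
Variables (T : eqType) (le : rel T).
Hypothesis le_order : total_order T le.

Lemma has_max_in_seq (s : seq T) (p : pred T) : has p s ->
  exists2 X, (X \in s) && p X & forall Y, Y \in s -> p Y -> le Y X.
Proof.
case: le_order => le_refl [_ [le_trans le_total]].
elim: s => [//|a s IHs] /=.
case: (boolP (has p s)) => [/IHs [X /andP [Xs pX] maxX] _|/hasPn Np]; last first.
  rewrite orbF => pa; exists a; first by rewrite mem_head pa.
  move=> Y; rewrite inE => /predU1P [-> _|/Np/negPf -> //]; exact: le_refl.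
case: (boolP (p a)) => pa; last first.
  exists X; first by rewrite inE Xs orbT.
  by move=> Y; rewrite inE => /predU1P [->|/maxX //]; rewrite (negPf pa).
case/orP: (le_total a X) => leaX.
  exists X; first by rewrite inE Xs orbT.
  by move=> Y; rewrite inE => /predU1P [->|/maxX].
exists a; first by rewrite mem_head pa.
move=> Y; rewrite inE => /predU1P [-> _|Ys pY]; first exact: le_refl.
exact: le_trans (maxX _ Ys pY) leaX.
Qed.

Variables (R : nzRingType).

(** The predicate given to [epsilon] always has a solution, because its [None] branch says precisely
    that no greatest monomial exists; antisymmetry makes the greatest one unique. *)
Lemma lmaxP (c : T -> R) X :
  lmax R T le c = Some X <-> c X != 0 /\ (forall Y, c Y != 0 -> le Y X).
Proof.
case: le_order => _ [le_anti _].
pose P (o : option T) := match o with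
  | Some X => c X != 0 /\ (forall Y, c Y != 0 -> le Y X)
  | None => forall X, ~ (c X != 0 /\ (forall Y, c Y != 0 -> le Y X)) end.
have exP : exists o, P o.
  case: (classic (exists X, P (Some X))) => [[Z ?]|noP]; first by exists (Some Z).
  by exists None => Z PZ; apply: noP; exists Z.
have : P (lmax R T le c) by exact: epsilon_spec.
case: (lmax R T le c) => [Z|] PZ; split.
- by case=> <-.
- case=> cX maxX; congr Some; case: PZ => cZ maxZ.
  by apply: le_anti; rewrite maxX ?maxZ.
- by [].
- by move=> PX; case: (PZ X).
Qed.

Lemma lmax_fin (c : T -> R) (s : seq T) : (forall X, c X != 0 -> X \in s) ->
  (exists X, c X != 0) -> exists X, lmax R T le c = Some X.
Proof.
move=> cs [Z cZ].
have /has_max_in_seq [X /andP [_ cX] maxX] : has (fun X => c X != 0) s.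
  by apply/hasP; exists Z; rewrite ?cs.
by exists X; apply/lmaxP; split=> // Y cY; apply: maxX; rewrite ?cs.
Qed.

End FiniteMax.

(** * Coefficients with respect to the PBW basis *)

Section SigmaPBW.
Variables (R A : nzRingType) (n : nat) (iota : {rmorphism R -> A})
          (x : 'I_n -> A) (coef : A -> exps n -> R).
Hypothesis pbw : sigma_PBW_ext R A n iota x coef.

Local Notation mono := (mono A n x).

Lemma pbw_sum_widen (s t : seq (exps n)) (r : exps n -> R) :
  uniq s -> uniq t -> {subset s <= t} -> (forall al, al \notin s -> r al = 0) ->
  \sum_(al <- t) iota (r al) * mono al = \sum_(al <- s) iota (r al) * mono al.
Proof.
move=> us ut st r0; rewrite (bigID (mem s)) /= addrC big1 ?add0r; last first.
  by move=> al /r0 ->; rewrite rmorph0 mul0r.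
rewrite -big_filter; apply: perm_big; apply: uniq_perm => //.
  exact: filter_uniq.
by move=> al; rewrite mem_filter /=; case: (boolP (al \in s)) => // /st.
Qed.

(** Freeness is applied to the difference of two expansions; the computation rules for [coef] below
    all rest on this. *)
Lemma coef_unique (a : A) (s : seq (exps n)) (r : exps n -> R) :
  uniq s -> (forall al, al \notin s -> r al = 0) ->
  a = \sum_(al <- s) iota (r al) * mono al -> forall al, coef a al = r al.
Proof.
case: pbw => _ [_ [expand free _ _]] us r0 def_a al.
have [t [ut ct def_a']] := expand a.
(* [al] joins the list so that freeness also covers an exponent outside both supports. *)
pose u := undup (al :: s ++ t).
have uu : uniq u by exact: undup_uniq.
have su : {subset s <= u} by move=> be; rewrite mem_undup inE mem_cat => ->; rewrite orbT.
have tu : {subset t <= u} by move=> be; rewrite mem_undup inE mem_cat => ->; rewrite !orbT.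
apply/eqP; rewrite -subr_eq0; apply/eqP.
apply: (free u (fun al => coef a al - r al) uu); last by rewrite mem_undup mem_head.
under eq_bigr => be _ do rewrite rmorphB mulrBl.
rewrite sumrB (pbw_sum_widen _ _ _ us uu su r0) (pbw_sum_widen _ _ _ ut uu tu ct).
by rewrite -def_a -def_a' subrr.
Qed.

(** An actual list is extracted by description, so that sums can range over it; the filter discards
    exponents with zero coefficient, which the expansion axiom allows in its list. *)
Definition supp (a : A) : seq (exps n) :=
  let: conj _ (conj _ (And4 expand _ _ _)) := pbw in
  [seq al <- sval (constructive_indefinite_description _ (expand a)) | coef a al != 0].

Lemma mem_supp a al : (al \in supp a) = (coef a al != 0).
Proof.
rewrite /supp; case: pbw => _ [_ [expand _ _ _]].
case: constructive_indefinite_description => s [_ cs _] /=.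
rewrite mem_filter; case: (boolP (al \in s)) => [_|/cs ->]; first by rewrite andbT.
by rewrite eqxx.
Qed.

Lemma supp_uniq a : uniq (supp a).
Proof.
rewrite /supp; case: pbw => _ [_ [expand _ _ _]].
case: constructive_indefinite_description => s [us _ _] /=; exact: filter_uniq.
Qed.

Lemma supp_expand a : a = \sum_(al <- supp a) iota (coef a al) * mono al.
Proof.
rewrite /supp; case: pbw => _ [_ [expand _ _ _]].
case: constructive_indefinite_description => s [_ _ def_a] /=.
rewrite big_filter big_mkcond [LHS]def_a /=; apply: eq_bigr => al _.
by case: eqP => //= ->; rewrite rmorph0 mul0r.
Qed.

Lemma coef0 al : coef 0 al = 0.
Proof. by rewrite (coef_unique 0 [::] (fun=> 0)) // big_nil. Qed.

Lemma coefD a b al : coef (a + b) al = coef a al + coef b al.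
Proof.
case: pbw => _ [_ [expand _ _ _]].
have [s [us cs def_a]] := expand a; have [t [ut ct def_b]] := expand b.
have uu : uniq (undup (s ++ t)) by exact: undup_uniq.
have su : {subset s <= undup (s ++ t)}.
  by move=> be; rewrite mem_undup mem_cat => ->.
have tu : {subset t <= undup (s ++ t)}.
  by move=> be; rewrite mem_undup mem_cat => ->; rewrite orbT.
apply: (coef_unique _ _ (fun al => coef a al + coef b al) uu).
  by move=> be; rewrite mem_undup mem_cat => /norP [/cs -> /ct ->]; rewrite addr0.
under eq_bigr => be _ do rewrite rmorphD mulrDl.
rewrite big_split /= (pbw_sum_widen _ _ _ us uu su cs).
by rewrite (pbw_sum_widen _ _ _ ut uu tu ct) -def_a -def_b.
Qed.

Lemma coefZ r a al : coef (iota r * a) al = r * coef a al.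
Proof.
case: pbw => _ [_ [expand _ _ _]]; have [s [us cs def_a]] := expand a.
apply: (coef_unique _ _ (fun al => r * coef a al) us).
  by move=> be /cs ->; rewrite mulr0.
rewrite [in LHS]def_a mulr_sumr; apply: eq_bigr => be _.
by rewrite rmorphM mulrA.
Qed.

Lemma coef_mono al be : coef (mono al) be = (be == al)%:R.
Proof.
apply: (coef_unique _ [:: al] (fun be => (be == al)%:R)) => //.
  by move=> ga; rewrite inE => /negPf ->.
by rewrite big_seq1 eqxx rmorph1 mul1r.
Qed.

Lemma coefN a al : coef (- a) al = - coef a al.
Proof. by rewrite -mulN1r -(rmorphN1 iota) coefZ mulN1r. Qed.

Lemma coef_sum (I : Type) (r : seq I) (P : pred I) (F : I -> A) al :
  coef (\sum_(i <- r | P i) F i) al = \sum_(i <- r | P i) coef (F i) al.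
Proof.
by apply: (big_morph (coef^~ al)) => [a b|]; rewrite ?coefD ?coef0.
Qed.

Lemma mono0 : mono (zerox n) = 1.
Proof. by rewrite /mono big1 // => k _; rewrite ffunE expr0. Qed.

Lemma mono_unitx k : mono (unitx n k) = x k.
Proof.
rewrite /Defs.mono.
suff H (s : seq 'I_n) : uniq s ->
    \prod_(j <- s) x j ^+ unitx n k j = if k \in s then x k else 1.
  by rewrite H ?index_enum_uniq // mem_index_enum.
elim: s => [|j s IHs] /=; first by rewrite big_nil.
case/andP=> js us; rewrite big_cons IHs // ffunE inE eq_sym.
case: eqVneq => [->|_] /=; first by rewrite (negPf js) mulr1.
by rewrite mul1r.
Qed.

Lemma coef_iota r al : coef (iota r) al = r *+ (al == zerox n).
Proof. by rewrite -[iota r]mulr1 -mono0 coefZ coef_mono mulr_natr. Qed.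

Lemma degx0 : degx n (zerox n) = 0%N.
Proof. by rewrite /degx big1 // => k _; rewrite ffunE. Qed.

Lemma degxD a b : degx n (addx n a b) = (degx n a + degx n b)%N.
Proof.
by rewrite /degx -big_split; apply: eq_bigr => k _; rewrite ffunE.
Qed.

Lemma degx_unitx k : degx n (unitx n k) = 1%N.
Proof.
rewrite /degx (bigD1 k) //= ffunE eqxx big1 ?addn0 // => j /negPf jk.
by rewrite ffunE jk.
Qed.

Lemma addx_inj a : injective (addx n a).
Proof.
move=> b c /ffunP eq_bc; apply/ffunP => k.
by have := eq_bc k; rewrite !ffunE => /addnI.
Qed.

(** * The endomorphisms sigma_k *)

Local Notation sig := (sig R A n iota x coef).

(** The constant [d] sits at the exponent of degree 0 and cannot disturb the coefficient at
    [x k]. *)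
Lemma sig_unique k r c d : x k * iota r = iota c * x k + iota d -> sig k r = c.
Proof.
rewrite /Defs.sig => ->; rewrite coefD coefZ -mono_unitx coef_mono eqxx mulr1.
rewrite coef_iota; case: eqP => [/(congr1 (degx n))|]; last by rewrite addr0.
by rewrite degx_unitx degx0.
Qed.

Lemma var_scalar k r : exists d, x k * iota r = iota (sig k r) * x k + iota d.
Proof.
suff [c [d def_xr]] : exists c d, x k * iota r = iota c * x k + iota d.
  by exists d; rewrite def_xr (sig_unique _ _ _ _ def_xr).
case: (eqVneq r 0) => [->|r0].
  by exists 0, 0; rewrite rmorph0 mulr0 mul0r addr0.
case: pbw => _ [_ [_ _ comm _]]; have [c [_ [d def_d]]] := comm k r r0.
by exists c, d; rewrite -def_d addrC subrK.
Qed.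

Lemma sig1 k : sig k 1 = 1.
Proof. by apply: (sig_unique _ _ _ 0); rewrite rmorph1 rmorph0 mulr1 mul1r addr0. Qed.

Lemma sigM k r s : sig k (r * s) = sig k r * sig k s.
Proof.
have [d def_r] := var_scalar k r; have [e def_s] := var_scalar k s.
(* The constant is the twisted Leibniz rule delta(rs) = sigma(r) delta(s) + delta(r) s. *)
apply: (sig_unique _ _ _ (sig k r * e + d * s)).
rewrite rmorphM mulrA def_r mulrDl -[_ * x k * iota s]mulrA def_s mulrDr.
by rewrite !rmorphD !rmorphM !mulrA addrA.
Qed.

(** * Products of words modulo lower degree *)

(** [R] may have zero divisors, so being nonzero need not pass to products; having a left inverse
    does, and it also survives sigma_k. *)
Definition left_invertible (c : R) : Prop := exists c', c' * c = 1.

Lemma left_invertible_neq0 c : left_invertible c -> c != 0.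
Proof.
by case=> c' cc; apply/eqP => c0; move: cc; rewrite c0 mulr0 => /esym/eqP; rewrite oner_eq0.
Qed.

Lemma left_invertibleM c d :
  left_invertible c -> left_invertible d -> left_invertible (c * d).
Proof.
move=> [c' cc] [d' dd]; exists (d' * c').
by rewrite mulrA -(mulrA d') cc mulr1.
Qed.

Lemma left_invertible_sig k c : left_invertible c -> left_invertible (sig k c).
Proof. by case=> c' cc; exists (sig k c'); rewrite -sigM cc sig1. Qed.

Definition word (w : seq 'I_n) : A := \prod_(k <- w) x k.
Definition word_exp (w : seq 'I_n) : exps n := [ffun k => count_mem k w].
Definition mono_word (a : exps n) : seq 'I_n :=
  flatten [seq nseq (a k) k | k <- enum 'I_n].

Let leo : rel 'I_n := relpre val leq.

Lemma word_cat w1 w2 : word (w1 ++ w2) = word w1 * word w2.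
Proof. by rewrite /word big_cat. Qed.

Lemma word_cons k w : word (k :: w) = x k * word w.
Proof. by rewrite /word big_cons. Qed.

Lemma word_mono_word a : word (mono_word a) = mono a.
Proof.
rewrite /word /mono_word /Defs.mono big_flatten [LHS]big_map enumT [index_enum _]unlock.
by apply: eq_bigr => k _; rewrite big_nseq iter_mulr mulr1.
Qed.

Lemma word_exp_mono_word a : word_exp (mono_word a) = a.
Proof.
apply/ffunP => k; rewrite ffunE count_flatten sumnE 2!big_map big_enum /=.
rewrite (bigD1 k) //= count_nseq /= eqxx mul1n big1 ?addn0 // => j /negPf jk.
by rewrite count_nseq /= jk.
Qed.

Lemma degx_word_exp w : degx n (word_exp w) = size w.
Proof.
rewrite /degx; under eq_bigr => k _ do rewrite ffunE -sum1_count.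
rewrite (exchange_big_dep predT) //= -sum1_size; apply: eq_bigr => k _.
by rewrite (big_pred1 k).
Qed.

Lemma size_mono_word a : size (mono_word a) = degx n a.
Proof. by rewrite -degx_word_exp word_exp_mono_word. Qed.

Lemma mono_word_sorted a : sorted leo (mono_word a).
Proof.
have leo_trans : transitive leo by move=> ? ? ?; exact: leq_trans.
rewrite /mono_word; have : sorted (relpre val ltn) (enum 'I_n).
  by rewrite -sorted_map val_enum_ord iota_ltn_sorted.
rewrite !sorted_pairwise //; last by move=> ? ? ?; exact: ltn_trans.
elim: (enum 'I_n) => [//|k s IHs] /= /andP [/allP ks /IHs {}IHs].
rewrite pairwise_cat IHs andbT; apply/andP; split.
  apply/allrelP => i j /nseqP [-> _] /flatten_mapP [l ls /nseqP [-> _]].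
  exact: ltnW (ks _ ls).
by elim: (a k) => //= c ->; rewrite andbT; apply/allP => j /nseqP [-> _]; exact: leqnn.
Qed.

Lemma sorted_mono_word w : sorted leo w -> mono_word (word_exp w) = w.
Proof.
move=> sw; apply: (@sorted_eq _ leo) => //.
- by move=> ? ? ?; exact: leq_trans.
- by move=> i j /anti_leq /val_inj.
- exact: mono_word_sorted.
apply/allP => k _ /=; move/ffunP/(_ k): (word_exp_mono_word (word_exp w)).
by rewrite !ffunE => ->.
Qed.

Lemma word_sorted w : sorted leo w -> word w = mono (word_exp w).
Proof. by move=> sw; rewrite -word_mono_word sorted_mono_word. Qed.

(* [low d] is the left R-span of the words of length less than d; by [low_coef] it
   consists of elements of degree less than d. *)
Inductive low (d : nat) : A -> Prop :=
  | low0 : low d 0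
  | low_cons r w a : (size w < d)%N -> low d a -> low d (iota r * word w + a).

Lemma lowD d a b : low d a -> low d b -> low d (a + b).
Proof.
move=> la lb; elim: la => [|r w a' wd _ IH]; first by rewrite add0r.
by rewrite -addrA; apply: low_cons.
Qed.

Lemma lowZ d r a : low d a -> low d (iota r * a).
Proof.
elim=> [|s w a' wd _ IH]; first by rewrite mulr0; exact: low0.
by rewrite mulrDr mulrA -rmorphM; apply: low_cons.
Qed.

Lemma low_word d r w : (size w < d)%N -> low d (iota r * word w).
Proof. by move=> wd; rewrite -[_ * _]addr0; apply: low_cons => //; exact: low0. Qed.

(** In x_k r w = sigma_k(r) x_k w + delta_k(r) w, one word gains a letter and the other keeps its
    length. *)
Lemma low_var d k a : low d a -> low d.+1 (x k * a).
Proof.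
elim=> [|r w a' wd _ IH]; first by rewrite mulr0; exact: low0.
have [e xr] := var_scalar k r.
rewrite mulrDr mulrA xr mulrDl -[_ * x k * _]mulrA -word_cons -addrA.
apply: lowD; first exact: low_word.
by apply: lowD => //; apply: low_word; rewrite ltnW.
Qed.

Lemma low_wordr d w a : low d a -> low (d + size w) (a * word w).
Proof.
elim=> [|r v a' vd _ IH]; first by rewrite mul0r; exact: low0.
rewrite mulrDl -mulrA -word_cat; apply: lowD => //.
by apply: low_word; rewrite size_cat ltn_add2r.
Qed.

Definition word_reduces (w w' : seq 'I_n) : Prop :=
  exists c, left_invertible c /\ low (size w) (word w - iota c * word w').

Lemma word_reduces_refl w : word_reduces w w.
Proof.
exists 1; split; first by exists 1; rewrite mulr1.
by rewrite rmorph1 mul1r subrr; exact: low0.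
Qed.

Lemma word_reduces_trans w1 w2 w3 : size w1 = size w2 ->
  word_reduces w1 w2 -> word_reduces w2 w3 -> word_reduces w1 w3.
Proof.
move=> eq12 [c [cc lc]] [d [dd ld]]; exists (c * d); split.
  exact: left_invertibleM.
rewrite -[word w1](subrK (iota c * word w2)) -addrA; apply: lowD => //.
by rewrite rmorphM -mulrA -mulrBr; apply: lowZ; rewrite eq12.
Qed.

(** Moving x_k past the factor c turns it into sigma_k(c), again left invertible, and leaves
    delta_k(c) w', which is shorter than [k :: w]. *)
Lemma word_reduces_cons k w w' : size w = size w' ->
  word_reduces w w' -> word_reduces (k :: w) (k :: w').
Proof.
move=> eqw [c [cc lc]]; exists (sig k c); split; first exact: left_invertible_sig.
have [d xc] := var_scalar k c.
have -> : word (k :: w) - iota (sig k c) * word (k :: w') =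
          x k * (word w - iota c * word w') + iota d * word w'.
  rewrite !word_cons mulrBr !mulrA xc mulrDl opprD addrA.
  by rewrite subrK.
by apply: lowD; [exact: low_var | apply: low_word; rewrite /= eqw].
Qed.

Lemma word_reduces_swap (j k : 'I_n) s : (j < k)%N ->
  word_reduces (k :: j :: s) (j :: k :: s).
Proof.
move=> ltjk; case: pbw => _ [_ [_ _ _ comm]].
have [c [_ [r0 [r def_c]]]] := comm j k.
have [c' [_ [r0' [r' def_c']]]] := comm k j.
exists c; split.
  pose e := word_exp [:: j; k].
  have xjk : x j * x k = mono e.
    rewrite -word_sorted; last by rewrite /= andbT; exact: ltnW.
    by rewrite /word !big_cons big_nil mulr1.
  (* The right-hand sides of the commutation relations have degree at most one, while [e] has degree
     two. *)
  have linear0 q0 (q : 'I_n -> R) : coef (iota q0 + \sum_(l < n) iota (q l) * x l) e = 0.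
    have e2 : degx n e = 2 by rewrite degx_word_exp.
    rewrite coefD coef_iota coef_sum big1 ?addr0 => [|l _].
      by case: eqP => // e0; move: e2; rewrite e0 degx0.
    rewrite coefZ -mono_unitx coef_mono; case: eqP => [e1|_]; last by rewrite mulr0.
    by move: e2; rewrite e1 degx_unitx.
  (* Coefficients at x_j x_k are compared in both relations: the first shows that x_k x_j has
     coefficient c there, and the second then gives c' c = 1. *)
  have := congr1 (coef^~ e) def_c'; have := congr1 (coef^~ e) def_c.
  rewrite /= !linear0 !coefD !coefN -!mulrA !coefZ xjk coef_mono eqxx mulr1 => /eqP.
  rewrite subr_eq0 => /eqP ->; move/eqP; rewrite subr_eq0 => /eqP cc.
  by exists c'.
have -> : word [:: k, j & s] - iota c * word [:: j, k & s] =
          (iota r0 + \sum_(l < n) iota (r l) * x l) * word s.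
  by rewrite -def_c !word_cons mulrBl !mulrA.
rewrite mulrDl mulr_suml; apply: lowD; first exact: low_word.
apply: big_ind => [|a b|l _]; [exact: low0 | exact: lowD |].
by rewrite -mulrA -word_cons; exact: low_word.
Qed.

(** One round of insertion sort: the letter [k] moves right past the smaller letters, one exchange
    at a time. *)
Lemma word_insert k w : sorted leo w ->
  exists w', [/\ sorted leo w', perm_eq w' (k :: w) & word_reduces (k :: w) w'].
Proof.
have leo_trans : transitive leo by move=> ? ? ?; exact: leq_trans.
elim: w => [|j s IHs] sw.
  by exists [:: k]; split=> //; exact: word_reduces_refl.
case: (leqP k j) => [lekj|ltjk].
  by exists [:: k, j & s]; split=> //; [apply/andP | exact: word_reduces_refl].
have [s' [ss' ps' rs']] := IHs (path_sorted sw).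
exists (j :: s'); split.
- rewrite /= path_sortedE // ss' andbT; apply/allP => l.
  rewrite (perm_mem ps') inE => /predU1P [->|]; first exact: ltnW.
  by move: sw; rewrite /= path_sortedE // => /andP [/allP sj _] /sj.
- rewrite -(perm_cons j) in ps'; apply: perm_trans ps' _.
  by apply/permP => p /=; rewrite addnCA.
apply: (word_reduces_trans _ [:: j, k & s]) => //; first exact: word_reduces_swap.
by apply: word_reduces_cons => //; rewrite (perm_size ps').
Qed.

Lemma word_sort w :
  exists w', [/\ sorted leo w', perm_eq w' w & word_reduces w w'].
Proof.
elim: w => [|k w [w1 [sw1 pw1 rw1]]].
  by exists [::]; split=> //; exact: word_reduces_refl.
have [w2 [sw2 pw2 rw2]] := word_insert k w1 sw1.
exists w2; split=> //; first by rewrite (perm_trans pw2) // perm_cons.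
have sz : size w = size w1 by rewrite (perm_size pw1).
apply: (word_reduces_trans _ (k :: w1)) => //=; first by rewrite sz.
exact: word_reduces_cons.
Qed.

Lemma word_mono w : exists c, left_invertible c /\
  low (size w) (word w - iota c * mono (word_exp w)).
Proof.
have [w' [sw' /permP pw' [c [cc lc]]]] := word_sort w.
exists c; split=> //; rewrite (_ : word_exp w = word_exp w'); last first.
  by apply/ffunP => k; rewrite !ffunE pw'.
by rewrite -word_sorted.
Qed.

(** By strong induction on [d]: a word of length below [d] is a scalar multiple of its standard
    monomial, whose degree is that length, plus an element of the span of still shorter words. *)
Lemma low_coef d a al : low d a -> coef a al != 0 -> (degx n al < d)%N.
Proof.
elim/ltn_ind: d a => d IHd a; elim=> [|r w a' wd _ IHa]; first by rewrite coef0 eqxx.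
rewrite coefD; case: (eqVneq (coef a' al) 0) => [->|/IHa //]; rewrite addr0 coefZ.
have [c [_ lc]] := word_mono w; rewrite -[word w](subrK (iota c * mono (word_exp w))).
rewrite coefD coefZ coef_mono; case: (eqVneq al (word_exp w)) => [->|_].
  by rewrite degx_word_exp.
rewrite mulr0 addr0; case: (eqVneq (coef (word w - iota c * mono (word_exp w)) al) 0).
  by move=> ->; rewrite mulr0 eqxx.
by move=> /(IHd _ wd _ lc) lt _; exact: ltn_trans lt wd.
Qed.

Lemma low_coef0 a al : low (degx n al) a -> coef a al = 0.
Proof. by move=> la; apply/eqP/negPn/negP => /(low_coef _ _ _ la); rewrite ltnn. Qed.

Local Notation cab := (cab R A n x coef).
Local Notation sigpow := (sigpow R A n iota x coef).

(** The words of x^a and x^b are concatenated and sorted. Reading the coefficient at a+b, to which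
    the remainder of lower degree does not contribute, identifies the resulting factor with
    [cab a b]. *)
Lemma mono_mul a b : left_invertible (cab a b) /\
  low (degx n a + degx n b) (mono a * mono b - iota (cab a b) * mono (addx n a b)).
Proof.
have [c [cc]] := word_mono (mono_word a ++ mono_word b).
have -> : word_exp (mono_word a ++ mono_word b) = addx n a b.
  rewrite -{2}(word_exp_mono_word a) -{2}(word_exp_mono_word b).
  by apply/ffunP => k; rewrite !ffunE count_cat.
rewrite word_cat !word_mono_word size_cat !size_mono_word => lc.
suff -> : cab a b = c by [].
have /eqP := low_coef0 _ (addx n a b) (eq_ind_r (low ^~ _) lc (degxD a b)).
by rewrite coefD coefN coefZ coef_mono eqxx mulr1 subr_eq0 => /eqP.
Qed.

Lemma cab_neq0 a b : cab a b != 0.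
Proof. by apply: left_invertible_neq0; case: (mono_mul a b). Qed.

Lemma word_scalar w r :
  low (size w) (word w * iota r - iota (foldr sig r w) * word w).
Proof.
elim: w => [|k w IH] /=.
  by rewrite /word big_nil mul1r mulr1 subrr; exact: low0.
have [d xs] := var_scalar k (foldr sig r w).
have -> : word (k :: w) * iota r - iota (sig k (foldr sig r w)) * word (k :: w) =
    x k * (word w * iota r - iota (foldr sig r w) * word w) + iota d * word w.
  by rewrite !word_cons mulrBr !mulrA xs mulrDl opprD addrA subrK.
by apply: lowD; [exact: low_var | exact: low_word].
Qed.

Lemma foldr_sig_mono_word a r : foldr sig r (mono_word a) = sigpow a r.
Proof.
rewrite /mono_word /Defs.sigpow; elim: (enum 'I_n) => [//|k s IHs] /=.
by rewrite foldr_cat IHs; elim: (a k) => //= c ->.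
Qed.

Lemma mono_scalar a r :
  low (degx n a) (mono a * iota r - iota (sigpow a r) * mono a).
Proof.
by have := word_scalar (mono_word a) r; rewrite foldr_sig_mono_word word_mono_word size_mono_word.
Qed.

(** Two errors of lower degree add up: one from moving [r] past x^a, one from multiplying x^a by
    x^b. *)
Lemma mono_term a r b : low (degx n a + degx n b)
  (mono a * (iota r * mono b) - iota (sigpow a r * cab a b) * mono (addx n a b)).
Proof.
have [_ lab] := mono_mul a b; have la := mono_scalar a r.
have -> : mono a * (iota r * mono b) - iota (sigpow a r * cab a b) * mono (addx n a b)
  = (mono a * iota r - iota (sigpow a r) * mono a) * mono b
    + iota (sigpow a r) * (mono a * mono b - iota (cab a b) * mono (addx n a b)).
  by rewrite mulrBl mulrBr !mulrA rmorphM addrA subrK.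
apply: lowD; last exact: lowZ.
by rewrite -(word_mono_word b) -(size_mono_word b); exact: low_wordr.
Qed.

Lemma coef_mono_term a r b :
  coef (mono a * (iota r * mono b)) (addx n a b) = sigpow a r * cab a b.
Proof.
have := mono_term a r b; rewrite -degxD => /low_coef0 /eqP.
by rewrite coefD coefN coefZ coef_mono eqxx mulr1 subr_eq0 => /eqP.
Qed.

Lemma coef_mono_term_neq0 a r b ga : coef (mono a * (iota r * mono b)) ga != 0 ->
  ga = addx n a b \/ (degx n ga < degx n a + degx n b)%N.
Proof.
move=> nz; case: (eqVneq ga (addx n a b)) => [|ne]; [by left | right].
apply: (low_coef _ _ _ (mono_term a r b)).
by rewrite coefD coefN coefZ coef_mono (negPf ne) mulr0 subr0.
Qed.

(** * Leading monomials of vectors *)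

Variables (m : nat) (leA : rel (exps n)) (leM : rel (exps n * 'I_m)).
Hypothesis leA_order : monomial_order_A R A n x coef leA.
Hypothesis leM_order : monomial_order_Am R A n x coef m leA leM.

Local Notation vcoef := (vcoef R A n coef m).
Local Notation vlm := (vlm R A n coef m leM).
Local Notation lc := (lc R A n coef m leM).
Local Notation vexp := (vexp R A n coef m leM).
Local Notation red1 := (red1 R A n iota x coef m leM).
Local Notation redp := (redp R A n iota x coef m leM).

Let leM_total : total_order _ leM. Proof. by case: leM_order. Qed.

Lemma vcoef0 X : vcoef 0 X = 0.
Proof. by rewrite /Defs.vcoef mxE coef0. Qed.

Lemma vcoefD f g X : vcoef (f + g) X = vcoef f X + vcoef g X.
Proof. by rewrite /Defs.vcoef mxE coefD. Qed.

Lemma vcoefN f X : vcoef (- f) X = - vcoef f X.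
Proof. by rewrite /Defs.vcoef mxE coefN. Qed.

Lemma vcoefZ r f X : vcoef (iota r *: f) X = r * vcoef f X.
Proof. by rewrite /Defs.vcoef mxE coefZ. Qed.

Lemma vcoef_sum (I : Type) (r : seq I) (P : pred I) (F : I -> 'cV[A]_m) X :
  vcoef (\sum_(i <- r | P i) F i) X = \sum_(i <- r | P i) vcoef (F i) X.
Proof.
by apply: (big_morph (vcoef^~ X)) => [f g|]; rewrite ?vcoefD ?vcoef0.
Qed.

Lemma vlmP f X :
  vlm f = Some X <-> vcoef f X != 0 /\ (forall Y, vcoef f Y != 0 -> leM Y X).
Proof. exact: lmaxP. Qed.

Lemma vlm_exists f : f != 0 -> exists X, vlm f = Some X.
Proof.
move=> f0.
apply: (lmax_fin _ _ leM_total _ _ [seq (al, j) | j <- enum 'I_m, al <- supp (f j 0)]).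
  case=> al j fX; apply/allpairsPdep; exists j, al.
  by rewrite mem_enum mem_supp.
case: (classic (exists X, vcoef f X != 0)) => // noX; case/eqP: f0.
apply/matrixP => j k; rewrite ord1 mxE (supp_expand (f j 0)) big_seq big1 // => al.
by rewrite mem_supp => nz; case: noX; exists (al, j).
Qed.

Lemma vlm_lc f X : vlm f = Some X -> lc f = vcoef f X.
Proof. by rewrite /Defs.lc => ->. Qed.

Lemma vlm_vexp f X : vlm f = Some X -> vexp f = X.1.
Proof. by rewrite /Defs.vexp => ->. Qed.

(** The coefficient at a+b is nonzero, and every other monomial of the product has smaller degree,
    hence lies below by degree compatibility. *)
Lemma alm_mono a b : alm R A n coef leA (mono a * mono b) = Some (addx n a b).
Proof.
case: leA_order => ordA _ _ degA.
apply/lmaxP => //; split; first exact: cab_neq0.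
move=> ga; rewrite -[mono b]mul1r -(rmorph1 iota) => /coef_mono_term_neq0 [->|lt].
  by case: ordA => + _; apply.
by apply: degA; rewrite degxD.
Qed.

Lemma leM_add g a b i j : leM (a, i) (b, j) -> leM (addx n g a, i) (addx n g b, j).
Proof. by case: leM_order => _ _ + _ le => /(_ _ _ g _ _ _ _ le); apply; exact: alm_mono. Qed.

Definition ltM (X Y : exps n * 'I_m) : bool := (X != Y) && leM X Y.

Lemma leM_ltM_trans X Y Z : leM X Y -> ltM Y Z -> ltM X Z.
Proof.
case: leM_total => _ [le_anti [le_trans _]] leXY /andP [neYZ leYZ].
apply/andP; split; last exact: le_trans leYZ.
by apply: contra_neqN neYZ => /eqP eqXZ; apply: le_anti; rewrite leYZ -eqXZ.
Qed.

Lemma ltM_deg X Y : ltM X Y -> (degx n X.1 <= degx n Y.1)%N.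
Proof.
case: leM_order => [[_ [le_anti _]] _ _ degM] /andP [neXY leXY].
rewrite leqNgt; apply/negP => /degM leYX.
by move/eqP: neXY; apply; apply: le_anti; rewrite leXY.
Qed.

Lemma ltM_ind (P : exps n * 'I_m -> Prop) :
  (forall X, (forall Y, ltM Y X -> P Y) -> P X) -> forall X, P X.
Proof.
move=> IH X.
(* Every monomial below X has degree at most deg X, so lies in the finite list L. *)
pose L : seq (exps n * 'I_m) :=
  [seq ([ffun k => nat_of_ord (Y.1 k)], Y.2) |
    Y : {ffun 'I_n -> 'I_(degx n X.1).+1} * 'I_m <- enum predT].
have memL Y : (degx n Y.1 <= degx n X.1)%N -> Y \in L.
  move=> leYX; apply/mapP.
  exists ([ffun k => inord (Y.1 k)], Y.2); first by rewrite mem_enum.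
  case: Y leYX => Y j /= leYX; congr pair; apply/ffunP => k.
  rewrite !ffunE inordK // ltnS (leq_trans _ leYX) //.
  by rewrite /degx (bigD1 k) //= leq_addr.
(* Induction on the number of members of [L] strictly below [Z], for all [Z] of degree at most that
   of [X]. *)
have [N] := ubnP (count (ltM^~ X) L); move: (leqnn (degx n X.1)).
elim: N {-2}X => [//|N IHN] Z leZX cZ; apply: IH => Y ltYZ.
have leYX := leq_trans (ltM_deg _ _ ltYZ) leZX.
apply: IHN => //; rewrite -ltnS; apply: leq_trans cZ; rewrite ltnS.
have ltYY : ltM Y Y = false by rewrite /ltM eqxx.
(* Besides everything below [Y], the monomial [Y] itself lies below [Z]; this makes the count
   drop. *)
have sub : subpred (predU (pred1 Y) (ltM^~ Y)) (ltM^~ Z).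
  move=> W /= /predU1P [-> //|/andP [_ leWY]]; exact: leM_ltM_trans ltYZ.
apply: leq_trans (sub_count sub L).
have disj : count (predI (pred1 Y) (ltM^~ Y)) L = 0%N.
  rewrite (eq_count (a2 := pred0)) ?count_pred0 // => W /=.
  by case: eqP => // ->.
have := count_predUI (pred1 Y) (ltM^~ Y) L.
rewrite disj addn0 => ->; rewrite -add1n leq_add2r -has_count.
by apply/hasP; exists Y; rewrite ?memL //= eqxx.
Qed.

(** A term of [g] with exponent al contributes at a + al, bounded by translation invariance, and
    otherwise only in degrees below that of a + al. *)
Lemma vcoef_term_le a g b j Y : vlm g = Some (b, j) ->
  vcoef (mono a *: g) Y != 0 -> leM Y (addx n a b, j).
Proof.
case: leM_order => [[le_refl [_ [le_trans _]]] _ _ degM].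
case: Y => ga i /vlmP [_ maxg]; rewrite /Defs.vcoef mxE /= {1}(supp_expand (g i 0)).
rewrite mulr_sumr coef_sum => nz.
have [al] : exists2 al, al \in supp (g i 0) &
    coef (mono a * (iota (coef (g i 0) al) * mono al)) ga != 0.
  apply/hasP; apply: contraR nz => /hasPn all0; rewrite big_seq big1 // => al.
  by move/all0/negPn/eqP.
rewrite mem_supp => /(maxg (al, i)) /(leM_add a) le_al /coef_mono_term_neq0 [->//|lt].
by apply: le_trans le_al; apply: degM; rewrite /= degxD.
Qed.

(** Another term of [g] in component [j] could contribute at a+b only if its degree exceeded that of
    [b], and degree compatibility would then place it above lm(g). *)
Lemma vcoef_term_top a g b j : vlm g = Some (b, j) ->
  vcoef (mono a *: g) (addx n a b, j) = sigpow a (lc g) * cab a b.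
Proof.
case: leM_order => [[_ [le_anti _]] _ _ degM] lmg; rewrite (vlm_lc _ _ lmg).
case/vlmP: lmg => + maxg; rewrite /Defs.vcoef mxE /= => gb.
rewrite {1}(supp_expand (g j 0)) mulr_sumr coef_sum (bigD1_seq b) ?mem_supp //=.
  rewrite coef_mono_term big_seq_cond big1 ?addr0 // => al /andP [].
  rewrite mem_supp => g_al /eqP ne; apply/eqP/negPn/negP => /coef_mono_term_neq0.
  case=> [/addx_inj/esym //|]; rewrite degxD ltn_add2l => /(degM (al, j) (b, j)) le.
  case: ne; suff [] : (al, j) = (b, j) by [].
  by apply: le_anti; rewrite le (maxg (al, j)).
exact: supp_uniq.
Qed.

(** * Representations, reductions and syzygies *)

Variable G : seq 'cV[A]_m.
Hypothesis G_neq0 : forall g, g \in G -> g != 0.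

(* [rep P f]: f is a combination of terms r x^al g, with g in G, whose formal leading
   monomials x^al lm(g) all satisfy P. *)
Definition rep (P : exps n * 'I_m -> Prop) (f : 'cV[A]_m) : Prop :=
  exists2 a : 'cV[A]_m -> A, f = \sum_(g <- undup G) a g *: g &
    forall g al b j, g \in G -> vlm g = Some (b, j) -> coef (a g) al != 0 ->
      P (addx n al b, j).

Lemma rep0 P : rep P 0.
Proof.
exists (fun=> 0) => [|g al b j _ _]; last by rewrite coef0 eqxx.
by rewrite big1 // => g _; rewrite scale0r.
Qed.

Lemma repD P f1 f2 : rep P f1 -> rep P f2 -> rep P (f1 + f2).
Proof.
move=> [a1 -> P1] [a2 -> P2]; exists (fun g => a1 g + a2 g).
  by rewrite -big_split; apply: eq_bigr => g _; rewrite scalerDl.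
move=> g al b j gG lmg; rewrite coefD.
case: (eqVneq (coef (a1 g) al) 0) => [->|/(P1 _ _ _ _ gG lmg) //].
by rewrite add0r; exact: P2.
Qed.

Lemma repZ P r f : rep P f -> rep P (iota r *: f).
Proof.
move=> [a -> Pa]; exists (fun g => iota r * a g).
  by rewrite scaler_sumr; apply: eq_bigr => g _; rewrite scalerA.
move=> g al b j gG lmg; rewrite coefZ => nz; apply: (Pa _ _ _ _ gG lmg).
by apply: contra_neq nz => ->; rewrite mulr0.
Qed.

Lemma rep_sum P (I : Type) (r : seq I) (Q : pred I) (F : I -> 'cV[A]_m) :
  (forall i, Q i -> rep P (F i)) -> rep P (\sum_(i <- r | Q i) F i).
Proof. by move=> PF; apply: big_ind => //; [exact: rep0 | exact: repD]. Qed.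

Lemma rep_scale P c g : g \in G ->
  (forall al b j, vlm g = Some (b, j) -> coef c al != 0 -> P (addx n al b, j)) ->
  rep P (c *: g).
Proof.
move=> gG Pc; exists (fun h => if h == g then c else 0).
  rewrite (bigD1_seq g) ?mem_undup ?undup_uniq //= eqxx big1 ?addr0 // => h /negPf ->.
  by rewrite scale0r.
by move=> h al b j _; case: (h =P g) => [->|_]; [exact: Pc | rewrite coef0 eqxx].
Qed.

Lemma rep_term P r al g b j : g \in G -> vlm g = Some (b, j) -> P (addx n al b, j) ->
  rep P ((iota r * mono al) *: g).
Proof.
move=> gG lmg Pb; apply: rep_scale => // al' b' j'; rewrite lmg => -[<- <-].
by rewrite coefZ coef_mono; case: (al' =P al) => [-> //|_]; rewrite mulr0 eqxx.
Qed.

Lemma rep_submod_gen f : submod_gen A m G f -> rep (fun=> True) f.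
Proof.
by case=> a ->; apply: rep_sum => i _; apply: rep_scale => //; exact: mem_nth.
Qed.

Lemma vcoef_scale_neq0 c g Y : vcoef (c *: g) Y != 0 ->
  exists2 al, coef c al != 0 & vcoef (mono al *: g) Y != 0.
Proof.
rewrite {1}(supp_expand c) scaler_suml vcoef_sum => nz.
have /hasP [al] : has (fun al => vcoef ((iota (coef c al) * mono al) *: g) Y != 0) (supp c).
  apply: contraR nz => /hasPn all0; rewrite big_seq big1 // => al.
  by move/all0/negPn/eqP.
rewrite mem_supp => cal; rewrite -scalerA vcoefZ => nz'; exists al => //.
by apply: contra_neq nz' => ->; rewrite mulr0.
Qed.

Lemma rep_vcoef P f Y : rep P f -> vcoef f Y != 0 -> exists2 X, P X & leM Y X.
Proof.
move=> [a -> Pa]; rewrite vcoef_sum => nz.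
have /hasP [g] : has (fun g => vcoef (a g *: g) Y != 0) (undup G).
  apply: contraR nz => /hasPn all0; rewrite big_seq big1 // => g.
  by move/all0/negPn/eqP.
rewrite mem_undup => gG /vcoef_scale_neq0 [al ag nzY].
have [[b j] lmg] := vlm_exists _ (G_neq0 _ gG).
by exists (addx n al b, j); [exact: Pa ag | exact: vcoef_term_le nzY].
Qed.

(** A representation has finitely many formal leading monomials, and at least one because [f] is
    nonzero; [X] is the greatest. *)
Lemma rep_bounded P f : f != 0 -> rep P f -> exists2 X, P X & rep (leM^~ X) f.
Proof.
move=> f0 [a def_f Pa].
pose shift g al : option (exps n * 'I_m) := omap (fun X => (addx n al X.1, X.2)) (vlm g).
pose s := pmap id [seq shift g al | g <- undup G, al <- supp (a g)].
have memsP X : reflect (exists g al b j, [/\ g \in G, vlm g = Some (b, j),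
    coef (a g) al != 0 & X = (addx n al b, j)]) (X \in s).
  rewrite mem_pmap map_id; apply: (iffP allpairsPdep).
    case=> g [al []]; rewrite mem_undup mem_supp /shift => gG ag.
    by case lmg : (vlm g) => [[b j]|] //= [->]; exists g, al, b, j.
  case=> g [al [b [j [gG lmg ag ->]]]]; exists g, al.
  by rewrite mem_undup mem_supp /shift lmg.
have /(has_max_in_seq _ _ leM_total) [X /andP [/memsP [g [al [b [j [gG lmg ag ->]]]]] _] max] :
    has predT s.
  rewrite has_predT; case: (posnP (size s)) => // /size0nil s0; case/eqP: f0.
  rewrite def_f big_seq big1 // => g; rewrite mem_undup => gG.
  have [[b j] lmg] := vlm_exists _ (G_neq0 _ gG).
  rewrite (supp_expand (a g)) big_seq big1 ?scale0r // => al; rewrite mem_supp => ag.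
  suff : (addx n al b, j) \in s by rewrite s0.
  by apply/memsP; exists g, al, b, j.
exists (addx n al b, j); first exact: Pa ag.
exists a => // h be c i hG lmh ah; apply: max => //.
by apply/memsP; exists h, be, c, i.
Qed.

(** * Closure properties of the submodule generated by [G] *)

Lemma submod_genD f g : submod_gen A m G f -> submod_gen A m G g -> submod_gen A m G (f + g).
Proof.
move=> [a ->] [b ->]; exists (fun i => a i + b i).
by rewrite -big_split; apply: eq_bigr => i _; rewrite scalerDl.
Qed.

Lemma submod_genZ c f : submod_gen A m G f -> submod_gen A m G (c *: f).
Proof.
move=> [a ->]; exists (fun i => c * a i).
by rewrite scaler_sumr; apply: eq_bigr => i _; rewrite scalerA.
Qed.

Lemma submod_gen_mem g : g \in G -> submod_gen A m G g.
Proof.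
move=> gG; have iG : (index g G < size G)%N by rewrite index_mem.
exists (fun i => (i == Ordinal iG)%:R); rewrite (bigD1 (Ordinal iG)) //= eqxx scale1r.
rewrite nth_index // big1 ?addr0 // => i /negPf ->; exact: scale0r.
Qed.

Lemma submod_gen0 : submod_gen A m G 0.
Proof. by exists (fun=> 0); rewrite big1 // => i _; rewrite scale0r. Qed.

Lemma submod_gen_sum (I : Type) (r : seq I) (c : I -> A) (F : I -> 'cV[A]_m) :
  (forall i, F i \in G) -> submod_gen A m G (\sum_(i <- r) c i *: F i).
Proof.
move=> FG; apply: big_ind => [|f g|i _]; [exact: submod_gen0 | exact: submod_genD |].
exact/submod_genZ/submod_gen_mem.
Qed.

(** * Reduction steps and chains *)

Lemma red1_submod f h : red1 G f h -> submod_gen A m G f -> submod_gen A m G h.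
Proof.
case=> [[-> ->] //|[t [fs [r [al [fsG _ _ ->]]]]] Mf].
apply: submod_genD => //; rewrite -scaleN1r.
exact/submod_genZ/submod_gen_sum.
Qed.

(** The subtracted terms all sit at [X], and the condition on leading coefficients in a reduction
    step is exactly the cancellation of the coefficient there. *)
Lemma red1_lt f h X : vlm f = Some X -> red1 G f h ->
  rep (eq X) (f - h) /\ (forall Y, vcoef h Y != 0 -> ltM Y X).
Proof.
move=> lmf; have [fX maxf] := (vlmP f X).1 lmf.
case=> [[f0 _]|[t [fs [r [al [fsG lmfs lcf ->]]]]]].
  by move: fX; rewrite f0 vcoef0 eqxx.
rewrite opprB addrC subrK; split.
  apply: rep_sum => i _; have [b [j [lmi]]] := lmfs i; rewrite lmf => -[eqX].
  exact: rep_term lmi _.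
move=> Y; rewrite vcoefD vcoefN vcoef_sum => hY; apply/andP; split.
  apply: contra_neq hY => ->; rewrite -(vlm_lc _ _ lmf) lcf -sumrB big1 // => i _.
  have [b [j [lmi]]] := lmfs i; rewrite lmf => -[->].
  by rewrite (vlm_vexp _ _ lmi) -scalerA vcoefZ (vcoef_term_top _ _ _ _ lmi) mulrA subrr.
case: (eqVneq (vcoef f Y) 0) => [fY|/maxf //].
have /existsP [i] : [exists i, vcoef ((iota (r i) * mono (al i)) *: fs i) Y != 0].
  apply: contraR hY => /existsPn all0; rewrite fY big1 ?subrr // => i _.
  exact/eqP/negPn/all0.
have [b [j [lmi]]] := lmfs i; rewrite lmf => -[->].
rewrite -scalerA vcoefZ => nz; apply: vcoef_term_le lmi _.
by apply: contra_neq nz => ->; rewrite mulr0.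
Qed.

(** Each step of the chain subtracts terms at the current leading monomial, which stays below [X];
    adding up the steps represents [f]. *)
Lemma redp_rep f X : redp G f 0 -> (forall Y, vcoef f Y != 0 -> ltM Y X) -> rep (ltM^~ X) f.
Proof.
move h0 : 0 => h red; elim: red h0 => {f h} [f h|f g h] red.
  move=> h0; subst h; case: (eqVneq f 0) => [-> _|nf ltf]; first exact: rep0.
  have [Z lmf] := vlm_exists _ nf; have [[a + Pa] _] := red1_lt _ _ _ lmf red.
  rewrite subr0 => def_f; exists a => // k al b j kG lmk /(Pa _ _ _ _ kG lmk) <-.
  by apply: ltf; case/vlmP: lmf.
move=> _ IH h0; case: (eqVneq f 0) => [-> _|nf ltf]; first exact: rep0.
have [Z lmf] := vlm_exists _ nf; have [[a def_fg Pa] ltg] := red1_lt _ _ _ lmf red.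
have ltZ : ltM Z X by apply: ltf; case/vlmP: lmf.
rewrite -[f](subrK g); apply: repD.
  by exists a => // k al b j kG lmk /(Pa _ _ _ _ kG lmk) <-.
by apply: IH => // Y /ltg /andP [_ leYZ]; exact: leM_ltM_trans ltZ.
Qed.

Lemma GB_redp : (forall f, submod_gen A m G f -> f != 0 -> exists h, red1 G f h) ->
  forall f, submod_gen A m G f -> redp G f 0.
Proof.
move=> redG f Mf; case: (eqVneq f 0) => [->|nf]; first by apply: redp1; left.
have [X lmf] := vlm_exists _ nf; elim/ltM_ind: X f lmf Mf nf => X IH f lmf Mf nf.
have [h red] := redG f Mf nf; case: (eqVneq h 0) => [h0|nh].
  by apply: redp1; rewrite -h0.
have [Y lmh] := vlm_exists _ nh; apply: (redpS _ _ _ _ _ _ _ _ _ _ h) => //.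
apply: (IH Y) => //; last exact: red1_submod red Mf.
by have [_] := red1_lt _ _ _ lmf red; apply; case/vlmP: lmh.
Qed.

(** * Syzygies of leading coefficients *)

Local Notation expX := (expX R A n coef m leM).
Local Notation gam := (gam R A n coef m leM).
Local Notation syz_sum := (syz_sum R A n iota x coef m leM).
Local Notation syz_entry := (syz_entry R A n iota x coef m leM).
Local Notation in_SF := (in_SF R A n iota x coef m leM).
Local Notation gen_SF := (gen_SF R A n iota x coef m leM).
Local Notation XF_nonzero := (XF_nonzero R A n coef m leM).

Lemma vexp_le_expX F g k : g \in F -> (vexp g k <= expX F k)%N.
Proof. by move=> gF; rewrite ffunE; exact: leq_bigmax_seq. Qed.

Lemma gamK F g th : g \in F ->
  addx n (addx n (gam F g) th) (vexp g) = addx n (expX F) th.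
Proof.
move=> gF; apply/ffunP => k; have := vexp_le_expX F g k gF.
rewrite /addx /Defs.gam !ffunE; lia.
Qed.

Lemma syz_sum_submod F th b : {subset F <= G} -> submod_gen A m G (syz_sum F th b).
Proof. by move=> FG; apply: submod_gen_sum => i; apply/FG/mem_nth. Qed.

(** The coefficient of the sum at X_F + theta is the left-hand side of the syzygy equation. *)
Lemma syz_sum_lt F th b j : (forall g, g \in F -> exists b, vlm g = Some (b, j)) ->
  in_SF F th b -> forall Y, vcoef (syz_sum F th b) Y != 0 -> ltM Y (addx n (expX F) th, j).
Proof.
move=> lmF [_ syz] Y; rewrite /syz_sum vcoef_sum => nz.
have lmFi (i : 'I_(size F)) : vlm F`_i = Some (vexp F`_i, j).
  by have [c lmi] := lmF _ (mem_nth 0 (ltn_ord i)); rewrite (vlm_vexp _ _ lmi).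
apply/andP; split.
  apply: contra_neq nz => ->; rewrite -[RHS]syz; apply: eq_bigr => i _.
  rewrite -scalerA vcoefZ -(gamK _ _ _ (mem_nth 0 (ltn_ord i))).
  by rewrite (vcoef_term_top _ _ _ _ (lmFi i)).
have /existsP [i] : [exists i : 'I_(size F),
    vcoef ((iota b`_i * mono (addx n (gam F F`_i) th)) *: F`_i) Y != 0].
  apply: contraR nz => /existsPn all0; rewrite big1 // => i _.
  exact/eqP/negPn/all0.
rewrite -scalerA vcoefZ -(gamK _ _ _ (mem_nth 0 (ltn_ord i))) => nzi.
apply: vcoef_term_le (lmFi i) _.
by apply: contra_neq nzi => ->; rewrite mulr0.
Qed.

(** Left [R]-linearity of the sum in [b]; thanks to it only the generators of the syzygy module have
    to be reduced. *)
Lemma syz_sum_span F th b (Bs : seq (seq R)) (a : 'I_(size Bs) -> R) :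
  (forall i : 'I_(size F), b`_i = \sum_(j < size Bs) a j * (nth [::] Bs j)`_i) ->
  syz_sum F th b = \sum_(j < size Bs) iota (a j) *: syz_sum F th (nth [::] Bs j).
Proof.
move=> def_b; rewrite /Defs.syz_sum; under [RHS]eq_bigr => j _ do rewrite scaler_sumr.
rewrite exchange_big /=; apply: eq_bigr => i _; rewrite def_b rmorph_sum mulr_suml scaler_suml.
by apply: eq_bigr => j _; rewrite scalerA rmorphM mulrA.
Qed.

(** The induction is on a bound for the formal leading monomials of a representation, not on the
    leading monomial of [f]: when the top terms cancel, [f] stays the same and only its
    representation improves. *)
Lemma syz_red_reducible (B : seq 'cV[A]_m -> exps n -> seq (seq R)) :
  (forall F th, uniq F -> {subset F <= G} -> XF_nonzero F -> gen_SF F th (B F th)) ->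
  (forall F, uniq F -> {subset F <= G} -> XF_nonzero F ->
     forall th b, b \in B F th -> redp G (syz_sum F th b) 0) ->
  forall X f, rep (leM^~ X) f -> f != 0 -> exists h, red1 G f h.
Proof.
move=> genB redB X; elim/ltM_ind: X => -[de j0] IH f [a def_f le_a] nf.
set X := (de, j0) in IH le_a *.
pose dvdX g := if vlm g is Some (b, j) then (j == j0) && [forall k, b k <= de k]%N else false.
(* When lm(g) divides [X], [e g] is the only exponent that carries lm(g) to [X], and [top g] is its
   coefficient in [a g]. *)
pose e g : exps n := [ffun k => (de k - vexp g k)%N].
pose top g := coef (a g) (e g).
pose F := [seq g <- undup G | dvdX g].
have uF : uniq F by rewrite filter_uniq ?undup_uniq.
have FG : {subset F <= G} by move=> g; rewrite mem_filter mem_undup => /andP [].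
have dvdXP g : dvdX g -> vlm g = Some (vexp g, j0) /\ forall k, (vexp g k <= de k)%N.
  rewrite /dvdX /Defs.vexp; case: (vlm g) => [[b j]|] // /andP [/eqP -> /forallP].
  by [].
have eK g : dvdX g -> addx n (e g) (vexp g) = de.
  by move=> /dvdXP [_ le]; apply/ffunP => k; rewrite !ffunE subnK.
have FP (i : 'I_(size F)) : dvdX F`_i.
  by have := mem_nth 0 (ltn_ord i); rewrite mem_filter => /andP [].
(* [T] gathers all the terms sitting at [X], so what remains of the representation lies strictly
   below. *)
pose T := \sum_(i < size F) (iota (top F`_i) * mono (e F`_i)) *: F`_i.
have rep_rest : rep (ltM^~ X) (f - T).
  exists (fun g => a g - (if dvdX g then iota (top g) * mono (e g) else 0)).
    rewrite def_f /T -(big_mkord predT (fun i => (iota (top F`_i) * mono (e F`_i)) *: F`_i)).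
    rewrite -(big_nth 0 predT (fun g => (iota (top g) * mono (e g)) *: g)).
    rewrite big_filter [X in _ - X]big_mkcond -sumrB; apply: eq_bigr => g _; rewrite scalerBl.
    by case: (dvdX g) => //; rewrite scale0r.
  move=> g al b j gG lmg; rewrite coefD coefN => nz.
  have aX : coef (a g) al != 0.
    apply: contra_neq nz => ag; rewrite ag sub0r; case: (dvdX g); last by rewrite coef0 oppr0.
    rewrite coefZ coef_mono; case: eqP => [eal|_]; last by rewrite mulr0 oppr0.
    by rewrite /top -eal ag mul0r oppr0.
  apply/andP; split; last exact: le_a lmg aX.
  apply: contra_neq nz => -[def_de def_j].
  have dg : dvdX g.
    rewrite /dvdX lmg def_j eqxx; apply/forallP => k.
    by rewrite -def_de ffunE leq_addl.
  have -> : al = e g.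
    apply/ffunP => k; rewrite ffunE -def_de (vlm_vexp _ _ lmg) ffunE /=.
    by rewrite addnK.
  by rewrite dg coefZ coef_mono eqxx mulr1 subrr.
have ltf Y : vcoef (f - T) Y != 0 -> ltM Y X.
  by case/(rep_vcoef _ _ _ rep_rest) => Z ltZ leYZ; exact: leM_ltM_trans ltZ.
(* Since [f - T] has no coefficient at [X], that of [f] equals that of [T]. *)
have fX : vcoef f X = \sum_(i < size F) top F`_i * (sigpow (e F`_i) (lc F`_i) * cab (e F`_i) (vexp F`_i)).
  have /eqP : vcoef (f - T) X = 0.
    by apply/eqP/negPn/negP => /ltf; rewrite /ltM eqxx.
  rewrite vcoefD vcoefN subr_eq0 vcoef_sum => /eqP ->; apply: eq_bigr => i _.
  have [lmi _] := dvdXP _ (FP i).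
  by rewrite -scalerA vcoefZ -(vcoef_term_top _ _ _ _ lmi) eK.
case: (eqVneq (vcoef f X) 0) => [fX0|nfX]; last first.
  have lmf : vlm f = Some X.
    apply/vlmP; split=> // Y.
    have /rep_vcoef H : rep (leM^~ X) f by exists a.
    case/H => Z leZX leYZ; case: leM_total => _ [_ [le_trans _]].
    exact: le_trans leYZ leZX.
  (* [X] is the leading monomial of [f], and [fX] writes its leading coefficient in the required
     form, so subtracting [T] is one reduction step. *)
  exists (f - T); right; exists (size F), (fun i => F`_i), (fun i => top F`_i), (fun i => e F`_i).
  split=> //.
  - by move=> i; apply/FG/mem_nth.
  - move=> i; have [lmi _] := dvdXP _ (FP i).
    by exists (vexp F`_i), j0; rewrite lmi eK // lmf.
  - by rewrite (vlm_lc _ _ lmf) fX; apply: eq_bigr => i _; rewrite mulrA.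
(* If [T] too has a representation strictly below [X], so does [f], and its greatest formal leading
   monomial is a smaller bound. *)
suff repT : rep (ltM^~ X) T.
  have [Z ltZ repf] := rep_bounded _ _ nf (eq_ind _ _ (repD _ _ _ rep_rest repT) _ (subrK T f)).
  exact: IH ltZ _ repf nf.
case: (eqVneq F [::]) => [F0|nF].
  by rewrite /T F0 big_ord0; exact: rep0.
have lmF g : g \in F -> exists b, vlm g = Some (b, j0).
  by rewrite mem_filter => /andP [/dvdXP [lmg _] _]; exists (vexp g).
have XF : XF_nonzero F by split=> //; exists j0.
(* [X] is a common multiple of the leading monomials in [F], hence a multiple of X_F; the exponent
   of the quotient is [th]. *)
have leXF k : (expX F k <= de k)%N.
  rewrite ffunE; apply/bigmax_leqP_seq => g.
  by rewrite mem_filter => /andP [/dvdXP [_ le] _] _.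
pose th : exps n := [ffun k => (de k - expX F k)%N].
have gam_th g : g \in F -> addx n (gam F g) th = e g.
  move=> gF; apply/ffunP => k; rewrite /addx /Defs.gam /th /e !ffunE.
  have := leXF k; have := vexp_le_expX F g k gF; rewrite ffunE; lia.
have defX : (addx n (expX F) th, j0) = X.
  congr pair; apply/ffunP => k; rewrite /addx /th !ffunE.
  by have := leXF k; rewrite ffunE => /subnKC.
pose b := [seq top g | g <- F].
have nth_b (i : 'I_(size F)) : b`_i = top F`_i by rewrite (nth_map 0).
have defT : T = syz_sum F th b.
  by apply: eq_bigr => i _; rewrite nth_b gam_th // mem_nth.
(* The vanishing of the coefficient of [f] at [X] is the syzygy equation. *)
have bS : in_SF F th b.
  split; first by rewrite size_map.
  rewrite -[RHS]fX0 fX; apply: eq_bigr => i _.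
  by rewrite nth_b /Defs.syz_entry gam_th // mem_nth.
have [BS spanB] := genB F th uF FG XF; have [c def_b] := spanB b bS.
rewrite defT (syz_sum_span _ _ _ _ _ def_b); apply: rep_sum => i _; apply: repZ.
have Bi : nth [::] (B F th) i \in B F th by exact: mem_nth.
apply: redp_rep; first exact: redB.
by rewrite -defX; apply: syz_sum_lt; last exact: BS.
Qed.

End SigmaPBW.

Theorem theorem29 (R A : nzRingType) (n m : nat) (iota : {rmorphism R -> A})
    (x : 'I_n -> A) (coef : A -> {ffun 'I_n -> nat} -> R)
    (leA : rel {ffun 'I_n -> nat}) (leM : rel ({ffun 'I_n -> nat} * 'I_m))
    (G : seq 'cV[A]_m)
    (B : seq 'cV[A]_m -> {ffun 'I_n -> nat} -> seq (seq R)) :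
  sigma_PBW_ext R A n iota x coef ->
  left_noetherian R ->
  monomial_order_A R A n x coef leA ->
  monomial_order_Am R A n x coef m leA leM ->
  (forall g, g \in G -> g != 0) ->
  (exists f, submod_gen A m G f /\ f != 0) ->
  (forall F th, uniq F -> {subset F <= G} -> XF_nonzero R A n coef m leM F ->
     gen_SF R A n iota x coef m leM F th (B F th)) ->
  (is_GB R A n iota x coef m leM G (submod_gen A m G) <->
     (forall F, uniq F -> {subset F <= G} -> XF_nonzero R A n coef m leM F ->
        forall th b, b \in B F th ->
          redp R A n iota x coef m leM G (syz_sum R A n iota x coef m leM F th b) 0))
  /\
  (is_GB R A n iota x coef m leM G (submod_gen A m G) ->
     forall F, uniq F -> {subset F <= G} -> XF_nonzero R A n coef m leM F ->
        forall b, b \in B F (zerox n) ->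
          redp R A n iota x coef m leM G (syz_sum R A n iota x coef m leM F (zerox n) b) 0).
Proof.
move=> pbw _ ordA ordM G0 [f0 [Mf0 nf0]] genB.
have GB_syz : is_GB R A n iota x coef m leM G (submod_gen A m G) ->
    forall F, uniq F -> {subset F <= G} -> XF_nonzero R A n coef m leM F ->
    forall th b, b \in B F th ->
      redp R A n iota x coef m leM G (syz_sum R A n iota x coef m leM F th b) 0.
  case=> _ _ redG F _ FG _ th b _.
  apply: (GB_redp _ _ _ _ _ _ pbw _ _ _ ordA ordM _ redG).
  exact: syz_sum_submod.
split; last by move=> GB F uF FG XF b; exact: GB_syz.
split=> // redB; split.
- by apply: contra_neq nf0 => GE; case: Mf0 => a ->; move: a; rewrite GE => a; rewrite big_ord0.
- by move=> g gG; split; [exact: G0 | exact: submod_gen_mem].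
move=> f Mf nf.
have rf := rep_submod_gen _ _ _ iota x _ pbw _ leM _ _ Mf.
(* Any expression of [f] by the generators starts the descent, bounded by its greatest formal
   leading monomial. *)
have [X _ repX] := rep_bounded _ _ _ _ _ _ pbw _ _ _ ordM _ G0 _ _ nf rf.
exact: (syz_red_reducible _ _ _ _ _ _ pbw _ _ _ ordA ordM _ G0 _ genB redB _ _ repX nf).
Qed.
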